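(* Let $n\ge2$, $d\ge1$, $\alpha\in(0,1)$ and let $\boldsymbol\sigma$ be arbitrary positive noise levels (heteroscedastic model with $\sigma_i^\#=\sigma_{\pi^*(i)}$). Let $$\kappa=4\max\Big\{\Big(2\log\frac{8n^2}{\alpha}\Big)^{1/2},\ \Big(d\log\frac{4n^2}{\alpha}\Big)^{1/4}\Big\}$$ and $\bar\Theta_\kappa=\{\boldsymbol\theta\in(\mathbb R^d)^n:\ \bar\kappa(\boldsymbol\theta,\boldsymbol\sigma)\ge\kappa\}$. If $\hat\pi$ is either $\pi^{\mathrm{LSNS}}$ (computed with the known noise levels) or $\pi^{\mathrm{LSL}}$, then $$\max_{\pi^*\in\mathfrak S_n}\ \sup_{\boldsymbol\theta\in\bar\Theta_\kappa}\mathbf E_{\boldsymbol\theta,\boldsymbol\sigma,\pi^*}\big[\delta_H(\hat\pi,\pi^* )\big]\le\alpha.$$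
   Context: Model: integers $n\ge2$, $d\ge1$. Unknown parameters: $\boldsymbol\theta=(\theta_1,\dots,\theta_n)$ with $\theta_i\in\mathbb R^d$, noise levels $\boldsymbol\sigma=(\sigma_1,\dots,\sigma_n)$ with $\sigma_i>0$, and a permutation $\pi^*\in\mathfrak S_n$ (the symmetric group on $\{1,\dots,n\}$). One observes $X_i=\theta_i+\sigma_i\xi_i$, $X_i^\#=\theta_{\pi^*(i)}+\sigma_i^\#\xi_i^\#$, $i=1,\dots,n$, where $\sigma_i^\#=\sigma_{\pi^*(i)}$ and $\xi_1,\dots,\xi_n,\xi_1^\#,\dots,\xi_n^\#$ are i.i.d. $\mathcal N(0,I_d)$. The law of the data is $\mathbf P_{\boldsymbol\theta,\boldsymbol\sigma,\pi^*}$ with expectation $\mathbf E_{\boldsymbol\theta,\boldsymbol\sigma,\pi^*}$. Ties in argmins are broken arbitrarily (measurably). Estimators: $\pi^{\mathrm{LSNS}}=\arg\min_{\pi\in\mathfrak S_n}\sum_{i=1}^n\frac{\|X_{\pi(i)}-X_i^\#\|^2}{\sigma_{\pi(i)}^2+(\sigma_i^\#)^2}$ and $\pi^{\mathrm{LSL}}=\arg\min_{\pi\in\mathfrak S_n}\sum_{i=1}^n\log\|X_{\pi(i)}-X_i^\#\|^2$. Relative separation distance: $\bar\kappa(\boldsymbol\theta,\boldsymbol\sigma)=\min_{i\ne j}\frac{\|\theta_i-\theta_j\|}{(\sigma_i^2+\sigma_j^2)^{1/2}}$. Normalized Hamming distance: $\delta_H(\pi,\pi')=\frac1n\sum_{k=1}^n\mathbb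 1_{\{\pi(k)\ne\pi'(k)\}}$. *)

(* Defs.v *)
From HB Require Import structures.
From mathcomp Require Import all_boot all_order all_algebra all_fingroup.
From mathcomp Require Import all_classical all_reals all_analysis.
Set Implicit Arguments. Unset Strict Implicit. Unset Printing Implicit Defensive.
Import Order.TTheory GRing.Theory Num.Theory.
Local Open Scope classical_set_scope.
Local Open Scope ring_scope.

(* Mutual independence of a finite family of real random variables:
   product rule for every family of Borel sets (subfamilies are obtained by
   taking B i = setT). *)
Definition mutually_independent (dT : measure_display) (T : measurableType dT)
  (R : realType) (P : probability T R) (I : finType) (X : I -> T -> R) : Prop :=
  forall B : I -> set R, (forall i, measurable (B i)) ->
    P (\bigcap_(i in [set: I]) (X i @^-1` B i)) =
    (\big[*%E/1%E]_(i : I) P (X i @^-1` B i))%E.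

Definition standard_normal (dT : measure_display) (T : measurableType dT)
  (R : realType) (P : probability T R) (X : T -> R) : Prop :=
  measurable_fun setT X /\
  forall B : set R, measurable B -> P (X @^-1` B) = normal_prob 0 1 B.

Definition sqnorm (R : realType) (d : nat) (v : 'I_d -> R) : R :=
  \sum_(j < d) v j ^+ 2.

Definition vsub (R : realType) (d : nat) (u v : 'I_d -> R) : 'I_d -> R :=
  fun j => u j - v j.

Definition rel_sep_ge (R : realType) (n d : nat) (theta : 'I_n -> 'I_d -> R)
  (sigma : 'I_n -> R) (k : R) : Prop :=
  forall i j : 'I_n, i != j ->
    k <= Num.sqrt (sqnorm (vsub (theta i) (theta j)))
           / Num.sqrt (sigma i ^+ 2 + sigma j ^+ 2).

Definition kappa_thr (R : realType) (n d : nat) (alpha : R) : R :=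
  4 * Num.max (Num.sqrt (2 * ln (8 * (n%:R) ^+ 2 / alpha)))
              (Num.sqrt (Num.sqrt (d%:R * ln (4 * (n%:R) ^+ 2 / alpha)))).

Definition delta_H {R : realType} (n : nat) (p q : 'S_n) : R :=
  (n%:R)^-1 * (#|[set k : 'I_n | p k != q k]|)%:R.

(* LSNS criterion, with the known noise levels: sigma_i^# = sigma (pistar i) *)
Definition LSNS_crit (R : realType) (n d : nat) (X Xs : 'I_n -> 'I_d -> R)
  (sigma : 'I_n -> R) (pistar pi : 'S_n) : R :=
  \sum_(i < n) sqnorm (vsub (X (pi i)) (Xs i))
                / (sigma (pi i) ^+ 2 + sigma (pistar i) ^+ 2).

Definition LSL_crit (R : realType) (n d : nat) (X Xs : 'I_n -> 'I_d -> R)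
  (pi : 'S_n) : R :=
  \sum_(i < n) ln (sqnorm (vsub (X (pi i)) (Xs i))).

Definition is_argmin (R : realType) (n : nat) (crit : 'S_n -> R) (p : 'S_n) :=
  forall q : 'S_n, crit p <= crit q.

(* the observations, as functions of the noise
   xi false i j = (xi_i)_j,  xi true i j = (xi_i^#)_j *)
Definition obsX (R : realType) (T : Type) (n d : nat) (theta : 'I_n -> 'I_d -> R)
  (sigma : 'I_n -> R) (xi : bool -> 'I_n -> 'I_d -> T -> R) (w : T) :
  'I_n -> 'I_d -> R :=
  fun i j => theta i j + sigma i * xi false i j w.

Definition obsXs (R : realType) (T : Type) (n d : nat) (theta : 'I_n -> 'I_d -> R)
  (sigma : 'I_n -> R) (pistar : 'S_n) (xi : bool -> 'I_n -> 'I_d -> T -> R)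
  (w : T) : 'I_n -> 'I_d -> R :=
  fun i j => theta (pistar i) j + sigma (pistar i) * xi true i j w.

(* Main.v *)
Require Import Defs.
From HB Require Import structures.
From mathcomp Require Import all_boot all_order all_algebra all_fingroup.
From mathcomp Require Import all_classical all_reals all_analysis.
From mathcomp Require Import measurable_realfun ring lra.
Import Order.TTheory GRing.Theory Num.Theory.
Local Open Scope classical_set_scope.
Local Open Scope ring_scope.

(* For i, j put W_ij = |X_j - X_i^#|^2 / (sigma_j^2 + sigma_pi*(i)^2); this is
   |v + eta|^2 with eta standard Gaussian in R^d, where v = 0 if j = pi*(i) and
   |v| >= kappa otherwise.  Since E exp(a |v + eta|^2) equals
   (1 - 2a)^(-d/2) exp(a |v|^2 / (1 - 2a)) for a < 1/2, Chernoff's bound with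
   |a| = min(1, m/d)/4 and m = kappa^2/16 shows that each of the events
   W_i,pi*(i) >= d + 5m and W_ij <= d + 5m (j <> pi*(i)) has probability at most
   alpha/(4n^2).  Off their union every mismatched W_ij exceeds every matched
   one, so the LSNS criterion is minimal only at pi*.  For LSL, AM-GM gives
   sigma_j^2 + sigma_i^2 >= 2 sigma_j sigma_i with equality on matched pairs,
   and the sum of the logarithms of the sigmas is invariant under permutations.
   Hence the estimator differs from pi* with probability at most alpha/4. *)

(** * Integration against a density and against image measures *)

Section density.
Local Open Scope ereal_scope.
Import HBNNSimple.

(** The last hypothesis says that [nu] is the image under [Z] of the measure with density [h] with
    respect to [mu]. It is the claim for indicators; linearity gives it for simple functions, and
    monotone convergence for nonnegative measurable ones. *)
Lemma ge0_integral_density (R : realType) (dT dU : measure_display)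
    (T : measurableType dT) (U : measurableType dU)
    (mu : {measure set T -> \bar R}) (nu : {measure set U -> \bar R})
    (Z : T -> U) (h : T -> R) :
  measurable_fun setT Z -> measurable_fun setT h -> (forall x, (0 <= h x)%R) ->
  (forall A, measurable A -> \int[mu]_x ((h x)%:E * (\1_A (Z x))%:E) = nu A) ->
  forall F : U -> \bar R, measurable_fun setT F -> (forall y, 0 <= F y) ->
  \int[mu]_x ((h x)%:E * F (Z x)) = \int[nu]_y F y.
Proof.
move=> mZ mh h0 hnu F mF F0.
have mhE : measurable_fun setT (EFin \o h) by exact/measurable_EFinP.
pose g := nnsfun_approx measurableT mF.
have step n : \int[mu]_x ((h x)%:E * (g n (Z x))%:E) = \int[nu]_y (g n y)%:E.
  transitivity (\int[mu]_x (\sum_(k \in range (g n))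
      (k%:E * ((h x)%:E * (\1_(g n @^-1` [set k]) (Z x))%:E)))).
    apply: eq_integral => x _.
    rewrite fimfunE -fsumEFin// ge0_mule_fsumr; last first.
      by move=> r; rewrite EFinM; exact: nnfun_muleindic_ge0.
    by apply: eq_fsbigr => k _; rewrite EFinM muleCA.
  rewrite ge0_integral_fsum//; last 2 first.
  - move=> r; apply: emeasurable_funM => //; apply: emeasurable_funM => //.
    by apply/measurable_EFinP; exact: measurableT_comp.
  - move=> r x _; rewrite muleCA mule_ge0 ?lee_fin//.
    exact: nnfun_muleindic_ge0.
  rewrite integralT_nnsfun sintegralE; apply: eq_fsbigr => k.
  (* The sum runs over values actually taken by [g n], so each coefficient is nonnegative and can
     leave the integral. *)
  rewrite inE => -[y _ <-{k}].
  rewrite ge0_integralZl//.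
  - by rewrite hnu.
  - apply: emeasurable_funM => //.
    by apply/measurable_EFinP; exact: measurableT_comp.
  - by move=> x _; rewrite mule_ge0 ?lee_fin.
  - by rewrite lee_fin.
transitivity (limn (fun n => \int[nu]_y (g n y)%:E)); last first.
  rewrite -monotone_convergence//.
  - apply: eq_integral => y _; apply/cvg_lim => //.
    by apply: cvg_nnsfun_approx.
  - by move=> n; exact/measurable_EFinP/measurable_funP.
  - by move=> n y _; rewrite lee_fin.
  - by move=> y _ m n mn; rewrite lee_fin; exact/lefP/nd_nnsfun_approx.
rewrite (_ : (fun n => _) =
    (fun n => \int[mu]_x ((h x)%:E * (g n (Z x))%:E))); last first.
  by apply/funext => n; rewrite step.
rewrite -monotone_convergence//.
- apply: eq_integral => x _; apply/esym/cvg_lim => //.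
  by apply: cvgeZl => //; apply: cvg_nnsfun_approx.
- move=> n; apply: emeasurable_funM => //.
  by apply/measurable_EFinP; apply: measurableT_comp.
- by move=> n y _; rewrite mule_ge0 ?lee_fin.
- move=> y _ m n mn; apply: lee_wpmul2l; first by rewrite lee_fin.
  by rewrite lee_fin; exact/lefP/nd_nnsfun_approx.
Qed.

End density.

Section product_law.
Local Open Scope ereal_scope.

(* The image by Z of the density h agrees with c (Q1 x Q2) on rectangles, hence
   everywhere by uniqueness of the product measure. *)
Lemma ge0_integral_density_prod (R : realType) (dT d1 d2 : measure_display)
    (T : measurableType dT) (T1 : measurableType d1) (T2 : measurableType d2)
    (mu : {measure set T -> \bar R}) (Q1 : probability T1 R)
    (Q2 : probability T2 R) (Z : T -> T1 * T2) (h : T -> R) (c : R) :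
  measurable_fun setT Z -> measurable_fun setT h -> (forall x, (0 <= h x)%R) ->
  (0 <= c)%R ->
  (forall A B, measurable A -> measurable B ->
    \int[mu]_x (h x * \1_(A `*` B) (Z x))%:E = c%:E * (Q1 A * Q2 B)) ->
  forall F : T1 * T2 -> \bar R, measurable_fun setT F -> (forall y, 0 <= F y) ->
  \int[mu]_x ((h x)%:E * F (Z x)) = c%:E * \int[Q1 \x Q2]_y F y.
Proof.
move=> mZ mh h0 c0 hrect F mF F0.
have mhE : measurable_fun setT (EFin \o h) by exact/measurable_EFinP.
pose lam (D : set (T1 * T2)) := \int[mu]_(x in Z @^-1` D) (h x)%:E.
have mZD D : measurable D -> measurable (Z @^-1` D).
  by move=> mD; rewrite -[_ @^-1` _]setTI; exact: mZ.
have lam0 : lam set0 = 0 by rewrite /lam preimage_set0 integral_set0.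
have lam_ge0 D : 0 <= lam D by apply: integral_ge0 => x _; rewrite lee_fin.
have lam_sigma : semi_sigma_additive lam.
  move=> D mD tD mUD; rewrite /lam preimage_bigcup ge0_integral_bigcup//.
  - by apply: is_cvg_ereal_nneg_natsum => n _; exact: lam_ge0.
  - by move=> n; exact: mZD.
  - exact: measurable_funTS.
  - by move=> x _; rewrite lee_fin.
  - apply/trivIsetP => /= i j _ _ ij; rewrite -preimage_setI.
    by move/trivIsetP : tD => /(_ _ _ _ _ ij) ->//; rewrite preimage_set0.
pose lamM : {measure set (T1 * T2) -> \bar R} :=
  HB.pack lam (isMeasure.Build _ _ _ lam lam0 lam_ge0 lam_sigma).
have lamE D : measurable D -> \int[mu]_x ((h x)%:E * (\1_D (Z x))%:E) = lam D.
  move=> mD; rewrite /lam [RHS]integral_mkcond; apply: eq_integral => x _.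
  rewrite patchE indicE [_ \in Z @^-1` D](_ : _ = (Z x \in D)); last first.
    by apply/idP/idP; rewrite !inE.
  by case: ifPn => _; rewrite ?mule1 ?mule0.
(* The constant is absorbed into the first factor, so that uniqueness applies to the product of the
   finite measures c Q1 and Q2. It is used twice: to identify this product with [lamM], then with c
   (Q1 x Q2). *)
pose Q1c := mscale (NngNum c0) Q1.
pose Q1cM : {finite_measure set T1 -> \bar R} := Q1c.
have lamP D : measurable D -> (Q1cM \x Q2) D = lamM D.
  apply: product_measure_unique => A B mA mB.
  rewrite /= -lamE; last exact: measurableX.
  by under eq_integral do rewrite -EFinM; rewrite hrect// muleA.
have lamQ D : measurable D -> lamM D = mscale (NngNum c0) (Q1 \x Q2) D.
  move=> mD; rewrite -lamP//; apply: product_measure_unique => // A B mA mB.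
  by rewrite /= /mscale/= product_measure1E// muleA.
rewrite (@ge0_integral_density _ _ _ _ _ _ lamM)//.
rewrite (eq_measure_integral (mscale (NngNum c0) (Q1 \x Q2))) => [|A mA _];
  last exact: lamQ.
by rewrite ge0_integral_mscale.
Qed.

End product_law.

(** * Factorization of expectations over independent pairs *)

Section independent_pairs.
Local Open Scope ereal_scope.
Context (R : realType) (dT d1 d2 : measure_display) (T : measurableType dT)
  (T1 : measurableType d1) (T2 : measurableType d2).
Variables (P : probability T R) (Q1 : probability T1 R) (Q2 : probability T2 R).
Variables (I : finType) (Z : I -> T -> T1 * T2).
Hypothesis mZ : forall k, measurable_fun setT (Z k).
Hypothesis rectZ : forall (A : I -> set T1) (B : I -> set T2),
  (forall k, measurable (A k)) -> (forall k, measurable (B k)) ->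
  P (\bigcap_(k in [set: I]) (Z k @^-1` (A k `*` B k))) =
  \prod_k (Q1 (A k) * Q2 (B k)).

Lemma expectation_prod_pairs (F : I -> T1 * T2 -> R) (e : I -> R) :
  (forall k, measurable_fun setT (F k)) -> (forall k y, (0 <= F k y)%R) ->
  (forall k, \int[Q1 \x Q2]_y (F k y)%:E = (e k)%:E) ->
  \int[P]_w (\prod_k F k (Z k w))%R%:E = (\prod_k e k)%R%:E.
Proof.
(* The functions F k are generalized from indicators of rectangles one index
   at a time; s lists the indices already treated. *)
have main (s : seq I) : forall (F : I -> T1 * T2 -> R) (e : I -> R),
    (forall k, measurable_fun setT (F k)) -> (forall k y, (0 <= F k y)%R) ->
    (forall k, \int[Q1 \x Q2]_y (F k y)%:E = (e k)%:E) ->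
    (forall k, k \notin s -> exists AB : set T1 * set T2,
      [/\ measurable AB.1, measurable AB.2 & F k = \1_(AB.1 `*` AB.2)]) ->
    \int[P]_w (\prod_k F k (Z k w))%R%:E = (\prod_k e k)%R%:E.
  elim: s => [|k0 s IH] {}F {}e mF F0 Fe Fs.
    have /choice[AB ABP] : forall k, exists AB : set T1 * set T2,
        [/\ measurable AB.1, measurable AB.2 & F k = \1_(AB.1 `*` AB.2)].
      by move=> k; exact: Fs.
    have mAB k : measurable ((AB k).1 `*` (AB k).2).
      by have [? ? _] := ABP k; exact: measurableX.
    have eE k : (e k)%:E = Q1 (AB k).1 * Q2 (AB k).2.
      rewrite -Fe; have [mA mB ->] := ABP k.
      by rewrite integral_indic ?setIT//; exact: product_measure1E.
    rewrite (big_morph EFin (@EFinM R) erefl).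
    under [RHS]eq_bigr do rewrite eE.
    rewrite -rectZ; last 2 first.
    - by move=> k; have [] := ABP k.
    - by move=> k; have [] := ABP k.
    set E := \bigcap_(_ in _) _.
    have mE : measurable E.
      apply: fin_bigcap_measurable => // k _.
      by rewrite -[_ @^-1` _]setTI; exact: mZ.
    transitivity (\int[P]_w (\1_E w)%:E); last by rewrite integral_indic// setIT.
    apply: eq_integral => w _; congr EFin.
    have [wE|wE] := boolP (w \in E).
      rewrite indicE wE big1// => k _; have [_ _ ->] := ABP k.
      by rewrite indicE mem_set//; move: wE; rewrite inE; exact.
    rewrite indicE (negbTE wE); apply/eqP; rewrite prodf_seq_eq0.
    move: wE; rewrite notin_setE => /existsNP[k /not_implyP[_ nk]].
    apply/hasP; exists k; rewrite ?mem_index_enum//=.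
    have [_ _ ->] := ABP k.
    by rewrite indicE memNset.
  (* The product of the other factors serves as a density: under it, [Z k0] has law c (Q1 x Q2),
     which allows an arbitrary [F k0]. *)
  pose h w := (\prod_(k | k != k0) F k (Z k w))%R.
  pose c := (\prod_(k | k != k0) e k)%R.
  have e0 k : (0 <= e k)%R.
    by rewrite -lee_fin -Fe; apply: integral_ge0 => y _; rewrite lee_fin.
  have mh : measurable_fun setT h.
    rewrite /h; under eq_fun do rewrite -big_filter.
    by apply: measurable_prod => k _; exact: measurableT_comp.
  under eq_integral do rewrite (bigD1 k0)//= mulrC EFinM.
  rewrite (bigD1 k0)//= mulrC EFinM -Fe.
  apply: (@ge0_integral_density_prod _ _ _ _ _ _ _ P Q1 Q2 (Z k0)
    h c _ mh _ _ _ (EFin \o F k0)) => //.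
  - by move=> w; exact: prodr_ge0.
  - exact: prodr_ge0.
  - move=> A B mA mB.
    have finAB : Q1 A * Q2 B \is a fin_num by rewrite fin_numM// fin_num_measure.
    rewrite -(fineK finAB).
    (* Replacing [F k0] by the indicator of a rectangle removes [k0] from the indices that need
       treatment, so the induction hypothesis yields the identity on rectangles. *)
    have := IH (fun k => if k == k0 then \1_(A `*` B) else F k)
               (fun k => if k == k0 then fine (Q1 A * Q2 B) else e k).
    rewrite (bigD1 k0)//= eqxx mulrC (eq_bigr e); last first.
      by move=> k /negbTE ->.
    rewrite EFinM => <-.
    + apply: eq_integral => w _; rewrite (bigD1 k0)//= eqxx mulrC; congr (_ * _)%:E.
      by apply: eq_bigr => k /negbTE ->.
    + by move=> k; case: ifP => // _; apply: measurable_indic; exact: measurableX.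
    + by move=> k y; case: ifP.
    + move=> k; case: ifP => // _; rewrite integral_indic ?setIT//;
        last exact: measurableX.
      by rewrite fineK//; exact: product_measure1E.
    + move=> k ks; case: ifP => [_|kk0]; first by exists (A, B).
      by apply: Fs; rewrite inE kk0.
  - exact/measurable_EFinP.
  - by move=> y; rewrite lee_fin.
move=> mF F0 Fe; apply: (main (enum I)) => // k.
by rewrite mem_enum.
Qed.

End independent_pairs.

(** * Gaussian integrals of exponentials of squares *)

Lemma ge0_integral_normal_prob (R : realType) (m s : R) (F : R -> \bar R) :
  measurable_fun setT F -> (forall x, 0 <= F x)%E ->
  (\int[normal_prob m s]_x F x =
   \int[lebesgue_measure]_x ((normal_pdf m s x)%:E * F x))%E.
Proof.
move=> mF F0; apply/esym.
apply: (@ge0_integral_density _ _ _ _ _ lebesgue_measure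
  (normal_prob m s) id (normal_pdf m s)) => //.
- exact: measurable_normal_pdf.
- by move=> x; exact: normal_pdf_ge0.
- move=> A mA; rewrite /= /normal_prob [RHS]integral_mkcond; apply: eq_integral => x _.
  by rewrite patchE indicE; case: ifPn => _; rewrite ?mule1 ?mule0.
Qed.

Lemma measurable_expR_quad (R : realType) (a v p : R) :
  measurable_fun setT (fun x : R => expR (a * (v + p * x) ^+ 2)).
Proof.
apply: measurableT_comp => //; apply: measurable_funM => //.
by apply: measurable_funX; exact: measurable_funD.
Qed.

(** Completing the square: -x^2/2 + a (v + p x)^2 = -(D/2) (x - 2 a p v / D)^2 + a v^2 / D. The
    tilted density is thus a multiple of a Gaussian density of variance 1/D. *)
Lemma normal_pdf_expR_quad (R : realType) (a v p x : R) :
  let D := 1 - 2 * a * p ^+ 2 in 0 < D ->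
  normal_pdf 0 1 x * expR (a * (v + p * x) ^+ 2) =
  Num.sqrt D^-1 * expR (a * v ^+ 2 / D) *
  normal_pdf (2 * a * p * v / D) (Num.sqrt D^-1) x.
Proof.
move=> D D0; have s0 : 0 < Num.sqrt D^-1 by rewrite sqrtr_gt0 invr_gt0.
rewrite !normal_pdfE ?oner_neq0 ?gt_eqF//.
have peak : Num.sqrt D^-1 * normal_peak (Num.sqrt D^-1) = normal_peak (1 : R).
  rewrite /normal_peak sqr_sqrtr ?invr_ge0 ?ltW// -!mulrnAr.
  rewrite sqrtrM ?invr_ge0 ?ltW// sqrtrM ?expr1n ?ler01// sqrtr1 mul1r.
  by rewrite invfM mulrA divff ?mul1r// gt_eqF.
rewrite [RHS]mulrACA peak -!mulrA; congr (_ * _).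
rewrite /normal_fun -!expRD; congr expR.
rewrite sqr_sqrtr ?invr_ge0 ?ltW// /D.
by field; rewrite -/D gt_eqF.
Qed.

Lemma normal_expR_quad (R : realType) (a v p : R) :
  let D := 1 - 2 * a * p ^+ 2 in 0 < D ->
  (\int[normal_prob 0 1]_x (expR (a * (v + p * x) ^+ 2))%:E =
   (Num.sqrt D^-1 * expR (a * v ^+ 2 / D))%:E)%E.
Proof.
move=> D D0; rewrite ge0_integral_normal_prob; last 2 first.
- by apply/measurable_EFinP; exact: measurable_expR_quad.
- by move=> x; rewrite lee_fin expR_ge0.
under eq_integral do rewrite -EFinM normal_pdf_expR_quad// EFinM.
rewrite ge0_integralZl//.
- by rewrite integral_normal_pdf mule1.
- by apply/measurable_EFinP; exact: measurable_normal_pdf.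
- by move=> x _; rewrite lee_fin normal_pdf_ge0.
Qed.

Lemma measurable_expR_quad2 (R : realType) (a v p q : R) :
  measurable_fun setT
    (fun z : R * R => expR (a * (v + p * z.1 + q * z.2) ^+ 2)).
Proof.
apply: measurableT_comp => //; apply: measurable_funM => //.
apply: measurable_funX; apply: measurable_funD; last exact: measurable_funM.
by apply: measurable_funD => //; exact: measurable_funM.
Qed.

(** By Tonelli the second variable is integrated first, which turns [a] into a / (1 - 2 a q^2) for
    the first one. Since p^2 + q^2 = 1, the two normalizing denominators multiply to 1 - 2 a. *)
Lemma normal2_expR_quad (R : realType) (a v p q : R) :
  p ^+ 2 + q ^+ 2 = 1 -> 2 * a < 1 ->
  (\int[normal_prob 0 1 \x normal_prob 0 1]_z
     (expR (a * (v + p * z.1 + q * z.2) ^+ 2))%:E =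
   (Num.sqrt (1 - 2 * a)^-1 * expR (a * v ^+ 2 / (1 - 2 * a)))%:E)%E.
Proof.
move=> pq a1.
have D1 : 0 < 1 - 2 * a * q ^+ 2.
  have := sqr_ge0 p; have := sqr_ge0 q; have [a0|a0] := leP a 0; nra.
have D12 : 1 - 2 * (a / (1 - 2 * a * q ^+ 2)) * p ^+ 2 =
    (1 - 2 * a) / (1 - 2 * a * q ^+ 2).
  have -> : p ^+ 2 = 1 - q ^+ 2 by rewrite -pq addrK.
  by field; rewrite gt_eqF.
rewrite fubini_tonelli1; last 2 first.
- by apply/measurable_EFinP; exact: measurable_expR_quad2.
- by move=> z; rewrite lee_fin expR_ge0.
rewrite /fubini_F /=.
under eq_integral do rewrite normal_expR_quad// EFinM [a * _ / _]mulrAC.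
rewrite ge0_integralZl//; last first.
  by apply/measurable_EFinP; exact: measurable_expR_quad.
have D2 : 0 < (1 - 2 * a) / (1 - 2 * a * q ^+ 2) by rewrite divr_gt0// subr_gt0.
rewrite normal_expR_quad D12// -EFinM mulrA -sqrtrM ?invr_ge0 ?(ltW D1)//.
congr (Num.sqrt _ * expR _)%:E; field; rewrite !gt_eqF// subr_gt0//.
Qed.

(** For standard Gaussian independent noise and p^2 + q^2 = 1, this is a noncentral chi-square
    variable with d degrees of freedom and noncentrality |v|^2. The index [j] belongs to the first
    sample and [i] to the second. *)
Definition noise_quad {R : realType} {T : Type} {n d : nat}
    (xi : bool -> 'I_n -> 'I_d -> T -> R) (p q : R) (v : 'I_d -> R)
    (i j : 'I_n) (w : T) : R :=
  \sum_k (v k + p * xi false j k w + q * xi true i k w) ^+ 2.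

(** * Exponential moments and Chernoff's bound for the noise quadratics *)

Section gaussian_noise.
Context {R : realType} {dT : measure_display} {T : measurableType dT}.
Context {P : probability T R} {n d : nat}.
Context {xi : bool -> 'I_n -> 'I_d -> T -> R}.
Hypothesis xiN : forall b i j, standard_normal P (xi b i j).
Hypothesis xi_indep : mutually_independent P
  (fun bij : bool * 'I_n * 'I_d => xi bij.1.1 bij.1.2 bij.2).

Lemma noise_pairs_rect (i j : 'I_n) (A B : 'I_d -> set R) :
  (forall k, measurable (A k)) -> (forall k, measurable (B k)) ->
  (P (\bigcap_(k in [set: 'I_d])
       ((fun w => (xi false j k w, xi true i k w)) @^-1` (A k `*` B k))) =
   \prod_k (normal_prob 0 1 (A k) * normal_prob 0 1 (B k)))%E.
Proof.
move=> mA mB.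
(* The rectangle constrains only the vectors xi_j and xi_i^#; all other coordinates get [setT] and
   contribute a factor 1. The boolean keeps the two vectors apart even when i = j. *)
pose C (t : bool * 'I_n * 'I_d) : set R :=
  if t.1.1 then (if t.1.2 == i then B t.2 else setT)
  else (if t.1.2 == j then A t.2 else setT).
have mC t : measurable (C t).
  by rewrite /C; case: ifP => _; case: ifP.
have xiP b i' k D : measurable D -> P (xi b i' k @^-1` D) = normal_prob 0 1 D.
  by move=> mD; exact: (xiN b i' k).2.
rewrite (_ : \bigcap_(k in _) _ =
    \bigcap_(t in [set: bool * 'I_n * 'I_d]) (xi t.1.1 t.1.2 t.2 @^-1` C t)).
  rewrite xi_indep// -(pair_bigA _ (fun bi k =>
    P (xi bi.1 bi.2 k @^-1` C (bi, k)))) exchange_big/=.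
  apply: eq_bigr => k _.
  rewrite -(pair_bigA _ (fun b i' => P (xi b i' k @^-1` C (b, i', k)))) big_bool/=.
  rewrite (bigD1 i)//= big1 ?mule1; last first.
    by move=> i' /negbTE ii'; rewrite /C/= ii' preimage_setT probability_setT.
  rewrite (bigD1 j)//= big1 ?mule1; last first.
    by move=> i' /negbTE ii'; rewrite /C/= ii' preimage_setT probability_setT.
  by rewrite /C/= !eqxx !xiP// muleC.
apply/seteqP; split => w /=.
  move=> wAB [[b i'] k] _; have [wA wB] := wAB k Logic.I.
  by rewrite /C/=; case: b; case: eqP => // ->.
move=> wC k _; split => /=.
  by have := wC (false, j, k) Logic.I; rewrite /C/= eqxx.
by have := wC (true, i, k) Logic.I; rewrite /C/= eqxx.
Qed.

Lemma measurable_noise_quad p q v i j :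
  measurable_fun setT (noise_quad xi p q v i j).
Proof.
apply: measurable_sum => k; apply: measurable_funX.
have m b l : measurable_fun setT (xi b l k) by have [] := xiN b l k.
by apply: measurable_funD; [apply: measurable_funD => //|];
  apply: measurable_funM.
Qed.

Lemma expectation_expR_noise_quad a p q v i j :
  p ^+ 2 + q ^+ 2 = 1 -> 2 * a < 1 ->
  (\int[P]_w (expR (a * noise_quad xi p q v i j w))%:E =
   (Num.sqrt (1 - 2 * a)^-1 ^+ d * expR (a * sqnorm v / (1 - 2 * a)))%:E)%E.
Proof.
move=> pq a1.
transitivity (\int[P]_w (\prod_k
    expR (a * (v k + p * xi false j k w + q * xi true i k w) ^+ 2))%:E)%E.
  by apply: eq_integral => w _; rewrite /noise_quad mulr_sumr expR_sum.
rewrite (@expectation_prod_pairs _ _ _ _ _ _ _ P (normal_prob 0 1)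
  (normal_prob 0 1) _ (fun k w => (xi false j k w, xi true i k w)) _ _
  (fun k z => expR (a * (v k + p * z.1 + q * z.2) ^+ 2))
  (fun k => Num.sqrt (1 - 2 * a)^-1 * expR (a * v k ^+ 2 / (1 - 2 * a)))).
- rewrite big_split/= -expR_sum big_const_ord iter_mulr_1; congr (_ * expR _)%:E.
  by rewrite /sqnorm mulr_sumr mulr_suml.
- by move=> k; apply: measurable_fun_pair;
    [have [] := xiN false j k|have [] := xiN true i k].
- by move=> A B mA mB; exact: noise_pairs_rect.
- by move=> k; exact: measurable_expR_quad2.
- by move=> k z; exact: expR_ge0.
- by move=> k; exact: normal2_expR_quad.
Qed.

(** Markov's inequality in the form 1_E <= exp(a W - c). The sign of [a] is free: positive values
    give upper tails and negative values lower tails. *)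
Lemma chernoff_noise_quad {a c p q} v i j :
  p ^+ 2 + q ^+ 2 = 1 -> 2 * a < 1 ->
  (P [set w | (c <= a * noise_quad xi p q v i j w)%R] <=
   (expR (- c) * (Num.sqrt (1 - 2 * a)^-1 ^+ d *
     expR (a * sqnorm v / (1 - 2 * a))))%:E)%E.
Proof.
move=> pq a1; set E := [set _ | _].
have mW : measurable_fun setT (fun w => a * noise_quad xi p q v i j w).
  by apply: measurable_funM => //; exact: measurable_noise_quad.
have mE : measurable E by rewrite -[E]setTI; exact: measurable_fun_le.
rewrite EFinM -(@expectation_expR_noise_quad a p q v i j)//.
rewrite -ge0_integralZl//; last first.
  by apply/measurable_EFinP; exact: measurableT_comp.
rewrite (_ : P E = \int[P]_w (\1_E w)%:E)%E; last by rewrite integral_indic// setIT.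
apply: ge0_le_integral => //.
- by apply/measurable_EFinP; exact: measurable_indic.
- apply: measurable_funeM.
  by apply/measurable_EFinP; exact: measurableT_comp.
move=> w _; rewrite -EFinM lee_fin -expRD indicE.
case: (boolP (w \in E)) => [|_]; last by rewrite expR_ge0.
by rewrite inE => wE; rewrite -expR0 ler_expR addrC subr_ge0.
Qed.

End gaussian_noise.

(** Squared, this is 1/(1 - 2a) = 1 + 2a/(1 - 2a) <= exp(2a/(1 - 2a)). It turns the prefactor of the
    exponential moment into an exponential, for either sign of [a]. *)
Lemma sqrt_inv_le_expR (R : realType) (a : R) : 2 * a < 1 ->
  Num.sqrt (1 - 2 * a)^-1 <= expR (a / (1 - 2 * a)).
Proof.
move=> a1; have D0 : 0 < 1 - 2 * a by rewrite subr_gt0.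
rewrite -(ger0_norm (expR_ge0 (a / _))) -sqrtr_sqr ler_sqrt ?sqr_ge0//.
rewrite expr2 -expRD; apply: le_trans (expR_ge1Dx _).
by rewrite le_eqVlt; apply/orP; left; apply/eqP; field; rewrite gt_eqF.
Qed.

(** * Tail bounds at the threshold d + 5m *)

Section tails.
Context {R : realType} {dT : measure_display} {T : measurableType dT}.
Context {P : probability T R} {n d : nat}.
Context {xi : bool -> 'I_n -> 'I_d -> T -> R}.
Hypothesis xiN : forall b i j, standard_normal P (xi b i j).
Hypothesis xi_indep : mutually_independent P
  (fun bij : bool * 'I_n * 'I_d => xi bij.1.1 bij.1.2 bij.2).
Context {p q : R} (i j : 'I_n).
Hypothesis pq : p ^+ 2 + q ^+ 2 = 1.
Context {m x : R}.
Hypotheses (m0 : 0 < m) (d0 : (0 < d)%N) (xm : x <= m) (dxm : d%:R * x <= m ^+ 2).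

(** With l = min(1, m/d)/4, the quantity 4 m l is either m or m^2/d, and the two hypotheses on [x]
    cover these two cases. The bounds on l and d l control the second-order terms in both tails. *)
Let chernoff_rate : exists l : R,
  [/\ 0 < l, l <= 1 / 4, d%:R * l <= m / 4 & x <= 4 * m * l].
Proof.
have D0 : 0 < d%:R :> R by rewrite ltr0n.
exists (Num.min 1 (m / d%:R) / 4); split.
- by rewrite divr_gt0// lt_min ltr01 divr_gt0.
- by rewrite ler_pM2r// ge_min lexx.
- rewrite mulrA ler_pM2r// -ler_pdivlMl// mulrC.
  by rewrite ge_min lexx orbT.
rewrite [leRHS](_ : _ = m * Num.min 1 (m / d%:R)); last by field.
have [_|_] := leP 1 (m / d%:R); first by rewrite mulr1.
by rewrite mulrA -expr2 ler_pdivlMr// mulrC.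
Qed.

(** Once the prefactor is bounded by an exponential, the Chernoff bound is a single exponential, and
    each tail reduces to comparing exponents. *)
Let chernoff_exponent (a c : R) (v : 'I_d -> R) : 2 * a < 1 ->
  - c + (d%:R * a + a * sqnorm v) / (1 - 2 * a) <= - x ->
  (P [set w | (c <= a * noise_quad xi p q v i j w)%R] <= (expR (- x))%:E)%E.
Proof.
move=> a1 cx; apply: le_trans (chernoff_noise_quad xiN xi_indep _ _ _ pq a1) _.
rewrite lee_fin; apply: le_trans (_ : _ <= expR (- c) *
  (expR (a / (1 - 2 * a)) ^+ d * expR (a * sqnorm v / (1 - 2 * a)))) _.
  rewrite ler_pM2l ?expR_gt0// ler_pM2r ?expR_gt0//.
  by rewrite lerXn2r ?nnegrE ?sqrtr_ge0 ?expR_ge0// sqrt_inv_le_expR.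
rewrite -expRM_natl -!expRD ler_expR; apply: le_trans cx.
by rewrite lerD2l mulrA -mulrDl.
Qed.

Lemma noise_quad_upper_tail :
  (P [set w | (d%:R + 5 * m <= noise_quad xi p q (fun=> 0) i j w)%R]
     <= (expR (- x))%:E)%E.
Proof.
have [l [l0 l4 dl xl]] := chernoff_rate.
rewrite (_ : [set _ | _] = [set w | l * (d%:R + 5 * m) <=
    l * noise_quad xi p q (fun=> 0) i j w]); last first.
  by apply/seteqP; split => w /=; rewrite ler_pM2l.
have l2 : 0 < 1 - 2 * l by lra.
apply: chernoff_exponent; first lra.
rewrite /sqnorm big1 ?mulr0 ?addr0 => [|k _]; last by rewrite expr0n.
have D0 : 0 < d%:R :> R by rewrite ltr0n.
(* For 0 <= l <= 1/4 one has 1/(1 - 2l) <= 1 + 4l. As d l <= m/4, the excess is at most m l, so the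
   exponent is at most -5 m l + m l = -4 m l <= -x. *)
have : d%:R * l / (1 - 2 * l) <= d%:R * l + 4 * (d%:R * l) * l.
  have : 0 <= d%:R * l * l * (1 - 4 * l) by rewrite !mulr_ge0 ?(ltW l0)//; lra.
  by rewrite ler_pdivrMr//; lra.
have : d%:R * l * l <= m / 4 * l by rewrite ler_pM2r.
lra.
Qed.

Lemma noise_quad_lower_tail (v : 'I_d -> R) : 16 * m <= sqnorm v ->
  (P [set w | (noise_quad xi p q v i j w <= d%:R + 5 * m)%R]
     <= (expR (- x))%:E)%E.
Proof.
move=> mv; have [l [l0 l4 dl xl]] := chernoff_rate.
rewrite (_ : [set _ | _] = [set w | (- l) * (d%:R + 5 * m) <=
    (- l) * noise_quad xi p q v i j w]); last first.
  by apply/seteqP; split => w /=; rewrite ler_nM2l// oppr_lt0.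
have l2 : 0 < 1 + 2 * l by lra.
apply: chernoff_exponent; first lra.
have D0 : 0 < d%:R :> R by rewrite ltr0n.
have ml : 0 < m * l by rewrite mulr_gt0.
have lv : 16 * m * l <= sqnorm v * l by rewrite ler_pM2r.
have dl0 : 0 < d%:R * l by rewrite mulr_gt0.
(* The dimension term uses 1/(1 + 2l) >= 1 - 2l; the signal term uses 1/(1 + 2l) >= 2/3, whence 16 *
   2/3 = 32/3. The exponent is then at most (5 + 1/2 - 32/3) m l, which is below -4 m l. *)
have : (d%:R * - l + - l * sqnorm v) / (1 - 2 * - l) <=
    - (d%:R * l) + 2 * (d%:R * l) * l - 32 / 3 * (m * l).
  have : 0 <= (d%:R * l) * l * l by rewrite !mulr_ge0// ltW.
  have : (m * l) * l <= (m * l) / 4 by rewrite ler_pM2l//; lra.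
  have -> : 1 - 2 * - l = 1 + 2 * l by ring.
  rewrite ler_pdivrMr//; lra.
have : d%:R * l * l <= m / 4 * l by rewrite ler_pM2r.
lra.
Qed.

(* The LSL criterion needs nonzero matched distances, because ln 0 = 0 here. *)
Lemma noise_quad_null :
  P [set w | noise_quad xi p q (fun=> 0) i j w <= 0] = 0%E.
Proof.
apply/eqP; rewrite eq_le measure_ge0 andbT; apply/lee_addgt0Pr => e e0.
rewrite add0e.
(* Chernoff's bound with a = -l and c = 0 gives (1 + 2l)^(-d/2). This is at most l^(-1/2) = e
   because d >= 1. *)
pose l := (e ^+ 2)^-1; have l0 : 0 < l by rewrite invr_gt0 exprn_gt0.
rewrite (_ : [set _ | _] = [set w | 0 <=
    - l * noise_quad xi p q (fun=> 0) i j w]); last first.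
  by apply/seteqP; split => w /=; rewrite mulNr oppr_ge0 pmulr_rle0.
have l2 : 2 * - l < 1 by lra.
apply: le_trans (chernoff_noise_quad xiN xi_indep _ _ _ pq l2) _.
rewrite oppr0 expR0 mul1r /sqnorm big1 => [|k _]; last by rewrite expr0n.
rewrite mulr0 mul0r expR0 mulr1 lee_fin.
set s := Num.sqrt _; have s0 : 0 <= s by exact: sqrtr_ge0.
have s1 : s <= 1.
  by rewrite -sqrtr1 ler_sqrt// invf_le1; lra.
have se : s <= e.
  rewrite -(ger0_norm (ltW e0)) -sqrtr_sqr ler_sqrt ?sqr_ge0//.
  rewrite -[e ^+ 2]invrK -/l lef_pV2 ?posrE; lra.
by apply: le_trans se; rewrite -{2}(expr1 s) ler_wiXn2l.
Qed.

End tails.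

(** * Deterministic comparison of the criteria *)

Lemma ltr_sum_ex (R : numDomainType) (I : finType) (f g : I -> R) (i0 : I) :
  (forall i, f i <= g i) -> f i0 < g i0 -> \sum_i f i < \sum_i g i.
Proof.
move=> fg fg0; rewrite (bigD1 i0)//= [ltRHS](bigD1 i0)//=.
by rewrite ltr_leD// ler_sum.
Qed.

Lemma perm_neq_ex (n : nat) (p q : 'S_n) : p <> q -> exists i, p i != q i.
Proof.
move=> pq; apply/existsP; rewrite -negb_forall; apply/negP => /forallP pq'.
by apply: pq; apply/permP => i; exact/eqP.
Qed.

Section argmin.
Context {R : realType} {n d : nat} {X Xs : 'I_n -> 'I_d -> R}
  {sigma : 'I_n -> R} {pistar : 'S_n} {b : R}.
Let dist i j := sqnorm (vsub (X j) (Xs i)).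
Let scale i j := sigma j ^+ 2 + sigma (pistar i) ^+ 2.
Hypothesis matched : forall i, dist i (pistar i) / scale i (pistar i) < b.
Hypothesis unmatched : forall i j, j != pistar i -> b < dist i j / scale i j.

(** The comparison is term by term: where [p] agrees with [pistar] the terms coincide, and elsewhere
    [b] separates them strictly. *)
Lemma LSNS_argmin_eq (p : 'S_n) :
  is_argmin (LSNS_crit X Xs sigma pistar) p -> p = pistar.
Proof.
move=> pmin; apply: contrapT => /perm_neq_ex[i0 pi0].
suff : LSNS_crit X Xs sigma pistar pistar < LSNS_crit X Xs sigma pistar p.
  by rewrite ltNge (pmin pistar).
apply: (@ltr_sum_ex _ _ _ _ i0) => [i|].
  have [->//|pi] := eqVneq (p i) (pistar i).
  by apply: ltW; apply: lt_trans (matched i) (unmatched i _ pi).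
exact: lt_trans (matched i0) (unmatched i0 _ pi0).
Qed.

Hypothesis sigma0 : forall i, 0 < sigma i.
Hypothesis matched_gt0 : forall i, 0 < dist i (pistar i) / scale i (pistar i).

Lemma LSL_argmin_eq (p : 'S_n) : is_argmin (LSL_crit X Xs) p -> p = pistar.
Proof.
move=> pmin; apply: contrapT => /perm_neq_ex[i0 pi0].
suff : LSL_crit X Xs pistar < LSL_crit X Xs p.
  by rewrite ltNge (pmin pistar).
pose r i j := dist i j / scale i j.
have scale0 i j : 0 < scale i j by rewrite addr_gt0// exprn_gt0.
have distE i j : dist i j = r i j * scale i j.
  by rewrite /r divfK// gt_eqF.
have r0 i j : 0 < r i j.
  have [->|ij] := eqVneq j (pistar i); first exact: matched_gt0.
  exact: lt_trans (lt_trans (matched_gt0 i) (matched i)) (unmatched i j ij).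
(* This is the logarithm of the AM-GM lower bound for [scale i (s i)], exact for s = [pistar]. Its
   sum over i does not depend on [s], so it cancels and only the normalized distances [r] are
   compared. *)
pose amgm (s : 'S_n) i := ln (2 * (sigma (s i) * sigma (pistar i))).
have amgm_sum (s : 'S_n) : \sum_i amgm s i =
    \sum_(i < n) ln (2 : R) + (\sum_i ln (sigma i) + \sum_i ln (sigma i)).
  have sumE (t : 'S_n) : \sum_i ln (sigma i) = \sum_i ln (sigma (t i)).
    exact: (reindex_perm t).
  rewrite [X in _ + (X + _)](sumE s) [X in _ + (_ + X)](sumE pistar) -!big_split/=.
  by apply: eq_bigr => i _; rewrite /amgm !lnM ?posrE ?mulr_gt0.
have crit_pistar :
    LSL_crit X Xs pistar = \sum_i (ln (r i (pistar i)) + amgm pistar i).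
  apply: eq_bigr => i _; rewrite -/(dist i _) distE lnM ?posrE//.
  by congr (_ + ln _); rewrite /scale; ring.
have crit_p : \sum_i (ln (r i (p i)) + amgm p i) <= LSL_crit X Xs p.
  apply: ler_sum => i _; rewrite -/(dist i _) distE lnM ?posrE// lerD2l.
  rewrite ler_ln ?posrE ?mulr_gt0// /scale.
  have := sqr_ge0 (sigma (p i) - sigma (pistar i)); lra.
apply: lt_le_trans crit_p; rewrite crit_pistar !big_split/= !amgm_sum ltrD2r.
have rlt i : p i != pistar i -> ln (r i (pistar i)) < ln (r i (p i)).
  move=> pi; rewrite ltr_ln ?posrE//.
  exact: lt_trans (matched i) (unmatched i _ pi).
apply: (@ltr_sum_ex _ _ _ _ i0) => [i|]; last exact: rlt.
by have [->//|/rlt/ltW] := eqVneq (p i) (pistar i).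
Qed.

End argmin.

(** * The Hamming loss, and the passage from the model to the tail bounds *)

Lemma delta_H_refl (R : realType) (n : nat) (p : 'S_n) : delta_H p p = 0 :> R.
Proof.
rewrite /delta_H eq_card0 ?mulr0// => k.
by apply/negbTE; rewrite notin_setE/= eqxx.
Qed.

Lemma delta_H_ge0 (R : realType) (n : nat) (p q : 'S_n) : 0 <= delta_H p q :> R.
Proof. by rewrite mulr_ge0 ?invr_ge0 ?ler0n. Qed.

Lemma delta_H_le1 (R : realType) (n : nat) (p q : 'S_n) : delta_H p q <= 1 :> R.
Proof.
rewrite /delta_H; case: n p q => [|n] p q; first by rewrite invr0 mul0r.
rewrite ler_pdivrMl ?ltr0n// mulr1 ler_nat.
by rewrite (leq_trans (max_card _))// card_ord.
Qed.

(** The composite is a finite linear combination of indicators of the fibers of [f]. This makes the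
    loss of the estimator integrable from measurability of its level sets alone. *)
Lemma measurable_fun_finite_fibers (dT : measure_display) (T : measurableType dT)
    (R : realType) (S : finType) (f : T -> S) (g : S -> R) :
  (forall s, measurable [set w | f w = s]) ->
  measurable_fun setT (fun w => g (f w)).
Proof.
move=> mf.
rewrite (_ : (fun w => _) =
    (fun w => \sum_s g s * \1_[set w | f w = s] w)); last first.
  apply/funext => w; rewrite (bigD1 (f w))//= indicE mem_set// mulr1 big1 ?addr0//.
  by move=> s sf; rewrite indicE memNset ?mulr0//= => fs; rewrite fs eqxx in sf.
apply: measurable_sum => s; apply: measurable_funM => //.
Qed.

(** Dividing by the standard deviation [s] of the difference normalizes the two noise coefficients,
    whose squares then sum to 1 when [s] is nonzero. *)
Lemma obs_noise_quad (R : realType) (T : Type) (n d : nat)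
    (theta : 'I_n -> 'I_d -> R) (sigma : 'I_n -> R) (pistar : 'S_n)
    (xi : bool -> 'I_n -> 'I_d -> T -> R) (i j : 'I_n) (w : T) :
  let s := Num.sqrt (sigma j ^+ 2 + sigma (pistar i) ^+ 2) in
  sqnorm (vsub (obsX theta sigma xi w j) (obsXs theta sigma pistar xi w i))
    / (sigma j ^+ 2 + sigma (pistar i) ^+ 2) =
  noise_quad xi (sigma j / s) (- sigma (pistar i) / s)
    (fun k => (theta j k - theta (pistar i) k) / s) i j w.
Proof.
move=> s; rewrite -[X in _ / X]sqr_sqrtr; last by rewrite addr_ge0// sqr_ge0.
rewrite -/s /sqnorm /noise_quad mulr_suml; apply: eq_bigr => k _.
by rewrite /vsub /obsX /obsXs -exprVn -exprMn; congr (_ ^+ 2); ring.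
Qed.

(** Writing the threshold as 4 M, take m = M^2 and x = log(4 n^2 / alpha). The square-root branch of
    the maximum gives x <= m, and the fourth-root branch gives d x <= m^2. *)
Lemma kappa_thr_rate (R : realType) (n d : nat) (alpha : R) :
  (0 < n)%N -> 0 < alpha < 1 -> exists m x : R,
  [/\ 0 < m, x <= m, d%:R * x <= m ^+ 2, kappa_thr n d alpha ^+ 2 = 16 * m
    & expR (- x) = alpha / (4 * n%:R ^+ 2)].
Proof.
move=> n0 /andP[a0 a1].
have n1 : 1 <= n%:R ^+ 2 :> R by rewrite exprn_ege1// ler1n.
pose x := ln (4 * n%:R ^+ 2 / alpha); pose y := ln (8 * n%:R ^+ 2 / alpha).
have q1 : 1 < 4 * n%:R ^+ 2 / alpha by rewrite ltr_pdivlMr//; lra.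
have x0 : 0 < x by rewrite ln_gt0.
have xy : x <= y.
  rewrite ler_ln ?posrE ?divr_gt0 ?mulr_gt0 ?exprn_gt0 ?ltr0n//.
  by rewrite ler_pM2r ?invr_gt0//; lra.
pose M := Num.max (Num.sqrt (2 * y)) (Num.sqrt (Num.sqrt (d%:R * x))).
have M2 : 2 * y <= M ^+ 2.
  rewrite -[leLHS]sqr_sqrtr; last lra.
  by rewrite lerXn2r ?nnegrE ?le_max ?sqrtr_ge0// lexx.
have dx0 : 0 <= d%:R * x by rewrite mulr_ge0// ltW.
have M4 : d%:R * x <= (M ^+ 2) ^+ 2.
  rewrite -[leLHS]sqr_sqrtr// lerXn2r ?nnegrE ?sqrtr_ge0 ?sqr_ge0//.
  rewrite -[leLHS]sqr_sqrtr ?sqrtr_ge0// lerXn2r ?nnegrE ?le_max ?sqrtr_ge0//.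
  by rewrite lexx orbT.
exists (M ^+ 2), x; split => //; [lra | lra | |].
  by rewrite /kappa_thr -/x -/y -/M exprMn; congr (_ * _); ring.
by rewrite expRN /x lnK ?posrE ?(lt_trans ltr01)// invf_div.
Qed.

Theorem theorem7 (R : realType) (dT : measure_display) (T : measurableType dT)
  (P : probability T R) (n d : nat) (alpha : R) (sigma : 'I_n -> R)
  (xi : bool -> 'I_n -> 'I_d -> T -> R) :
  (2 <= n)%N -> (1 <= d)%N -> 0 < alpha < 1 ->
  (forall i, 0 < sigma i) ->
  (forall b i j, standard_normal P (xi b i j)) ->
  mutually_independent P (fun bij : bool * 'I_n * 'I_d => xi bij.1.1 bij.1.2 bij.2) ->
  forall (pistar : 'S_n) (theta : 'I_n -> 'I_d -> R),
  rel_sep_ge theta sigma (kappa_thr n d alpha) ->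
  forall hat : T -> 'S_n,
  ((forall w, is_argmin (LSNS_crit (obsX theta sigma xi w)
                            (obsXs theta sigma pistar xi w) sigma pistar) (hat w))
   \/ (forall w, is_argmin (LSL_crit (obsX theta sigma xi w)
                            (obsXs theta sigma pistar xi w)) (hat w))) ->
  (forall s : 'S_n, measurable [set w | hat w = s]) ->
  (\int[P]_w (delta_H (hat w) pistar)%:E <= alpha%:E)%E.
Proof.
move=> n2 d1 a01 sigma0 xiN xi_indep pistar theta sep hat hatP mhat.
have n0 : (0 < n)%N by exact: ltn_trans n2.
have [m [x [m0 xm dxm kappaE expx]]] := @kappa_thr_rate R n d alpha n0 a01.
pose scale i j := sigma j ^+ 2 + sigma (pistar i) ^+ 2.
have scale0 i j : 0 < scale i j by rewrite addr_gt0// exprn_gt0.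
pose p i j := sigma j / Num.sqrt (scale i j).
pose q i j := - sigma (pistar i) / Num.sqrt (scale i j).
have pq i j : p i j ^+ 2 + q i j ^+ 2 = 1.
  rewrite /p /q !exprMn sqrrN !exprVn sqr_sqrtr ?ltW//.
  by rewrite -mulrDl divff// gt_eqF// scale0.
pose v i j (k : 'I_d) := (theta j k - theta (pistar i) k) / Num.sqrt (scale i j).
have v_matched i : v i (pistar i) = fun=> 0.
  by apply/funext => k; rewrite /v subrr mul0r.
have v_unmatched i j : j != pistar i -> 16 * m <= sqnorm (v i j).
  move=> ij; rewrite -kappaE.
  have -> : sqnorm (v i j) = (Num.sqrt (sqnorm (vsub (theta j) (theta (pistar i))))
      / Num.sqrt (scale i j)) ^+ 2.
    rewrite exprMn sqr_sqrtr; last by apply: sumr_ge0 => k _; exact: sqr_ge0.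
    by rewrite /sqnorm mulr_suml; apply: eq_bigr => k _; rewrite -exprMn.
  rewrite lerXn2r ?nnegrE ?divr_ge0 ?sqrtr_ge0//; last exact: sep.
  by rewrite /kappa_thr mulr_ge0// le_max sqrtr_ge0.
pose W i j := noise_quad xi (p i j) (q i j) (v i j) i j.
have mW i j : measurable_fun setT (W i j) by exact: measurable_noise_quad.
pose b := d%:R + 5 * m.
(* A matched pair is bad if its normalized distance is too large or zero, the latter only for the
   logarithms; a mismatched pair is bad if its distance is too small. *)
pose bad (ij : 'I_n * 'I_n) := let: (i, j) := ij in
  if j == pistar i then [set w | b <= W i j w] `|` [set w | W i j w <= 0]
  else [set w | W i j w <= b].
have mWle i j c : measurable [set w | W i j w <= c].
  by rewrite -[X in measurable X]setTI; exact: measurable_fun_le.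
have mleW i j c : measurable [set w | c <= W i j w].
  by rewrite -[X in measurable X]setTI; exact: measurable_fun_le.
have mbad ij : measurable (bad ij).
  by case: ij => i j; rewrite /bad; case: ifP => // _; exact: measurableU.
have Pbad ij : (P (bad ij) <= (expR (- x))%:E)%E.
  case: ij => i j; rewrite /bad /W; case: ifP => [/eqP ->|/negbT ij].
    apply: le_trans (measureU2 _ (mleW _ _ _) (mWle _ _ _)) _.
    rewrite /W v_matched [X in (_ + X)%E](_ : _ = 0%E); last exact: noise_quad_null.
    rewrite adde0.
    exact: noise_quad_upper_tail.
  by apply: noise_quad_lower_tail => //; exact: v_unmatched.
have good w : (forall ij, ~ bad ij w) -> hat w = pistar.
  move=> gw.
  have matched i : W i (pistar i) w < b /\ 0 < W i (pistar i) w.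
    have := gw (i, pistar i); rewrite /bad eqxx => /not_orP[/= + +].
    by move=> /negP + /negP; rewrite -!ltNge.
  have unmatched i j : j != pistar i -> b < W i j w.
    move=> ij; have := gw (i, j); rewrite /bad (negbTE ij) => /negP.
    by rewrite -ltNge.
  have WE i j : sqnorm (vsub (obsX theta sigma xi w j)
      (obsXs theta sigma pistar xi w i)) / scale i j = W i j w.
    exact: obs_noise_quad.
  case: hatP => hatP.
    apply: (LSNS_argmin_eq (b := b)) (hatP w) => [i|i j ij].
      by rewrite WE; have [] := matched i.
    by rewrite WE; exact: unmatched.
  apply: (LSL_argmin_eq (b := b)) (hatP w) => // [i|i j ij|i].
  - by rewrite WE; have [] := matched i.
  - by rewrite WE; exact: unmatched.
  - by rewrite WE; have [] := matched i.
(* Union bound inside the integral: the loss vanishes when no pair is bad and is at most 1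
   otherwise. *)
apply: (@le_trans _ _ (\int[P]_w \sum_ij (\1_(bad ij) w)%:E)%E).
  apply: ge0_le_integral => //.
  - by move=> w _; rewrite lee_fin delta_H_ge0.
  - apply/measurable_EFinP.
    exact: (@measurable_fun_finite_fibers _ _ _ _ hat (fun s => delta_H s pistar)).
  - apply: emeasurable_sum => ij; apply/measurable_EFinP.
    exact: measurable_indic.
  move=> w _; rewrite sumEFin lee_fin.
  have [[ij bw]|gw] := pselect (exists ij, bad ij w).
    rewrite (bigD1 ij)//= indicE mem_set//.
    apply: le_trans (delta_H_le1 _ _ _ _) _.
    by rewrite lerDl sumr_ge0.
  rewrite good ?delta_H_refl ?sumr_ge0// => ij bw.
  by apply: gw; exists ij.
rewrite ge0_integral_sum//; last first.
  by move=> ij; apply/measurable_EFinP; exact: measurable_indic.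
apply: (@le_trans _ _ (\sum_(ij : 'I_n * 'I_n) (expR (- x))%:E)%E).
  by apply: lee_sum => ij _; rewrite integral_indic// setIT; exact: Pbad.
(* There are n^2 pairs, each bad with probability at most alpha / (4 n^2), for a total of alpha /
   4. *)
rewrite sumEFin lee_fin sumr_const card_prod card_ord expx.
have nn : n%:R != 0 :> R by rewrite pnatr_eq0 -lt0n.
rewrite -[leLHS]mulr_natr natrM [leLHS](_ : _ = alpha / 4); last by field.
by case/andP: a01 => a0 _; lra.
Qed.
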